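(* (i) Each of the axiom schemes $\mathtt{mp}$, $\mathtt{minimp}$, $\mathtt{peirce}$, $\mathtt{contrap}$, $\mathtt{notelim}$, $\mathtt{gen}$, $\mathtt{ALLdistr}$, $\mathtt{vacGen}$, $\mathtt{EQrefl}$, $\mathtt{denot}$, $\mathtt{subst}$ and $\mathtt{modal5}$ is independent in $\mathtt{TMM}$; that is, none of these schemes $\Phi$ is provable from $\mathtt{TMM}\setminus\{\Phi\}$. (ii) Each of the axiom schemes $\mathtt{EQsymm}$ and $\mathtt{EQtrans}$ is independent in $\mathtt{TMM}\setminus\{\mathtt{subst},\mathtt{ALLeq}\}$ and is independent in $\mathtt{TMM}\setminus\{\mathtt{denot}\}$.
   Context: **Metavariables and metaformulas.** Let $\mathrm{vrMV}=\{x_i\mid i\in\omega\}$ (variable metavariables) and $\mathrm{fmMV}=\{\phi_i\mid i\in\omega\}$ (formula metavariables) be disjoint countably infinite sets of symbols, and $\mathrm{MV}=\mathrm{vrMV}\cup\mathrm{fmMV}$. A language $\mathcal L$ is a set of further symbols (nonlogical predicates) with an arity function $\mathcal L\to\omega$. Fix a language $\mathcal L$. A metaformula is one of: a formula metavariable; $x_i\equiv x_j$; $P(x_{i_1},\dots,x_{i_r})$ with $P\in\mathcal L$ of arity $r$; $\forall x_i\,\Phi$; $\neg\Phi$; $\Phi\to\Psi$, where $\Phi,\Psi$ are metaformulas. $\mathrm{MF}$ is the set of metaformulas. $\mathrm{OC}(\Phi)\subseteq\mathrm{MV}$ is the set of metavariables occurring in $\Phi$ (including those directly after a quantifier), and $\mathrm{OC}(x_i)=\{x_i\}$.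 For a set $X$, $\mathcal P_2(X)$ is the set of its two-element subsets. **Schemes.** A scheme $\Phi=(\{\Phi_1,\dots,\Phi_n\},\Phi_0,\mathrm{DV}(\Phi))$ consists of a finite set of metaformulas (hypotheses), a metaformula (conclusion), and a set $\mathrm{DV}(\Phi)\subseteq\mathcal P_2(\mathrm{OC}(\Phi))$ (disjoint variable conditions), where $\mathrm{OC}(\Phi)$ is the set of metavariables occurring in its hypotheses or conclusion. Writing $(\Phi_I,\Phi_0,D)$ with a larger $D$ means that $D$ is intersected with $\mathcal P_2(\mathrm{OC}(\Phi))$. Such a scheme is displayed as $\Phi_1\;\&\;\dots\;\&\;\Phi_n\Longrightarrow\Phi_0,\ \mathrm{DV}(\cdot,\cdot),\dots$, where $\mathrm{DV}(m,n)$ denotes the condition $\{m,n\}$. **Substitution and instances.** A substitution is a map $\sigma:\mathrm{MV}\to\mathrm{vrMV}\cup\mathrm{MF}$ with $\sigma(\mathrm{vrMV})\subseteq\mathrm{vrMV}$, $\sigma(\mathrm{fmMV})\subseteq\mathrm{MF}$ and $\sigma(m)=m$ for all but finitely many $m$. $\Phi^\sigma$ is the result of simultaneous plain substitution in the metaformula $\Phi$ (variable metavariables after quantifiers are also replaced). For $D\subseteq\mathcal P_2(\mathrm{MV})$, $D^\sigma=\{\{m,n\}\in\mathcal P_2(\mathrm{MV})\mid\exists\{m',n'\}\in D,\ m\in\mathrm{OC}(\sigma(m')),\ n\in\mathrm{OC}(\sigma(n'))\}$. $\sigma$ is legitimate on a scheme $\Phi$ if $\{m,n\}\in\mathrm{DV}(\Phi)$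 implies $\mathrm{OC}(\sigma(m))\cap\mathrm{OC}(\sigma(n))=\varnothing$. A scheme $\Psi$ is an instance of $\Phi$ if for some $\sigma$ legitimate on $\Phi$ the hypotheses and conclusion of $\Psi$ are the images under $\sigma$ of those of $\Phi$ and $\mathrm{DV}(\Phi)^\sigma\subseteq\mathrm{DV}(\Psi)$. **Proofs.** A proof of a scheme $\Phi$ from a set of schemes $S$ is a finite sequence $P$ of metaformulas (lines) whose last line is the conclusion of $\Phi$ and such that each line $P_i$ that is not a hypothesis of $\Phi$ admits $i_1,\dots,i_n<i$ for which $(\{P_{i_1},\dots,P_{i_n}\},P_i,\mathrm{DV}(P))$ is an instance of a scheme in $S$, where $\mathrm{DV}(P)=\mathrm{DV}(\Phi)\cup\{\{m,n\}\mid m\in\mathrm{OC}(P)\setminus\mathrm{OC}(\Phi),\ n\in\mathrm{OC}(P),\ m\ne n\}$ and $\mathrm{OC}(P)$ is the set of metavariables occurring in the lines of $P$ (or in $\Phi$). $\Phi$ is provable from $S$ if such a proof exists. A scheme is independent in a set of schemes containing it if it is not provable from the other schemes of that set. (Provability does not depend on the choice of the language containing the symbols involved.) **The system $\mathtt{TMM}$.** With $x,y,z$ distinct variable metavariables and $\phi,\psi,\chi,\theta,\tau$ distinct formula metavariables, $\mathtt{TMM}$ is the set of the following schemes: - $\mathtt{mp}$: $\phi\;\&\;\phi\to\psi\Longrightarrow\psi$ - $\mathtt{minimp}$: $\phi\to((\psi\to\chi)\to(((\theta\to\psi)\to(\chi\to\tau))\to(\psi\to\tau)))$ - $\mathtt{peirce}$: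 $((\phi\to\psi)\to\phi)\to\phi$ - $\mathtt{contrap}$: $(\phi\to\neg\psi)\to(\psi\to\neg\phi)$ - $\mathtt{notelim}$: $\neg\phi\to(\phi\to\psi)$ - $\mathtt{gen}$: $\phi\Longrightarrow\forall x\,\phi$ - $\mathtt{ALLdistr}$: $\forall x(\phi\to\psi)\to(\forall x\,\phi\to\forall x\,\psi)$ - $\mathtt{spec}$: $\forall x\,\phi\to\phi$ - $\mathtt{modal5}$: $\neg\forall x\,\phi\to\forall x\,\neg\forall x\,\phi$ - $\mathtt{vacGen}$: $\phi\to\forall x\,\phi,\ \mathrm{DV}(x,\phi)$ - $\mathtt{ALLcomm}$: $\forall x\forall y\,\phi\to\forall y\forall x\,\phi$ - $\mathtt{EQrefl}$: $x\equiv x$ - $\mathtt{EQsymm}$: $x\equiv y\to y\equiv x$ - $\mathtt{EQtrans}$: $x\equiv y\to(y\equiv z\to x\equiv z)$ - $\mathtt{denot}$: $x\equiv x\to\neg\forall y\,\neg\,y\equiv x,\ \mathrm{DV}(x,y)$ - $\mathtt{subst}$: $\forall x(x\equiv y\to(\phi\to\forall x(x\equiv y\to\phi))),\ \mathrm{DV}(x,y),\ \mathrm{DV}(y,\phi)$ - $\mathtt{ALLeq}$: $\forall x\,x\equiv y\to(\forall x\,\phi\to\forall y\,\phi)$ - $\mathtt{genEq}$: $\neg\forall x\,x\equiv y\to(\neg\forall x\,x\equiv z\to(y\equiv z\to\forall x\,y\equiv z))$ *)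

(* Defs.v *)
From mathcomp Require Import all_boot.
From mathcomp Require Import boolp classical_sets functions cardinality.

Set Implicit Arguments.
Unset Strict Implicit.
Unset Printing Implicit Defensive.

Local Open Scope classical_set_scope.

(* The metavariables x_i and phi_i are represented by their indices; the two
   constructors of [MV] keep the two families disjoint. *)
Definition vrMV := nat.
Definition fmMV := nat.

Inductive MV : Type :=
| Vr of vrMV
| Fm of fmMV.

Coercion Vr : vrMV >-> MV.
Coercion Fm : fmMV >-> MV.

Record language := Language {
  symbol :> Type;
  arity : symbol -> nat }.

Inductive MF (L : language) : Type :=
| Meta of fmMV
| Eqv of vrMV & vrMV
| Pred (P : L) of (arity P).-tuple vrMV
| All of vrMV & MF L
| Neg of MF L
| Imp of MF L & MF L.

Arguments Meta {L} _.
Arguments Eqv {L} _ _.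
Arguments Pred {L} P _.

Declare Scope mf_scope.
Delimit Scope mf_scope with MF.
Bind Scope mf_scope with MF.
Notation "a ~> b" := (Imp a b) (at level 60, right associativity) : mf_scope.
Notation "x === y" := (Eqv x y) (at level 50, no associativity) : mf_scope.

(* The set of the members of a list; the element types below carry no decidable
   equality, so [\in] is not available. *)
Fixpoint setOf (T : Type) (s : seq T) : set T :=
  if s is a :: s' then a |` setOf s' else set0.

Lemma finite_setOf (T : Type) (s : seq T) : finite_set (setOf s).
Proof. by elim: s => //= a s IHs; rewrite finite_setU. Qed.

Fixpoint OC (L : language) (a : MF L) : set MV :=
  match a with
  | Meta f => [set Fm f]
  | Eqv i j => [set Vr i; Vr j]
  | Pred _ t => Vr @` setOf (tval t)
  | All i b => Vr i |` OC b
  | Neg b => OC b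
  | Imp b c => OC b `|` OC c
  end.

Definition OCset (L : language) (H : set (MF L)) : set MV :=
  \bigcup_(a in H) OC a.

Definition P2 (T : Type) (X : set T) : set (set T) :=
  [set A | exists m n, [/\ X m, X n, m <> n & A = [set m; n]]].

Record scheme (L : language) := Scheme {
  hyps : set (MF L);
  concl : MF L;
  DV : set (set MV);
  hyps_finite : finite_set hyps;
  DV_P2 : DV `<=` P2 (OCset hyps `|` OC concl) }.

Definition OCscheme (L : language) (Phi : scheme L) : set MV :=
  OCset (hyps Phi) `|` OC (concl Phi).

(* The scheme (hs, c, D), where D is cut down to the pairs of metavariables
   that occur in hs or c. *)
Definition mkScheme (L : language) (hs : seq (MF L)) (c : MF L)
    (D : set (set MV)) : scheme L :=
  @Scheme L (setOf hs) c (D `&` P2 (OCset (setOf hs) `|` OC c))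
    (finite_setOf hs) (@subIsetr _ _ _).

Record substitution (L : language) := Substitution {
  sub_vr : vrMV -> vrMV;
  sub_fm : fmMV -> MF L;
  sub_vr_finite : finite_set [set i | sub_vr i <> i];
  sub_fm_finite : finite_set [set i | sub_fm i <> Meta i] }.

Fixpoint apply_sub (L : language) (s : substitution L) (a : MF L) : MF L :=
  match a with
  | Meta f => sub_fm s f
  | Eqv i j => Eqv (sub_vr s i) (sub_vr s j)
  | Pred P t => Pred P (map_tuple (sub_vr s) t)
  | All i b => All (sub_vr s i) (apply_sub s b)
  | Neg b => Neg (apply_sub s b)
  | Imp b c => Imp (apply_sub s b) (apply_sub s c)
  end.

(* OC(s(m)) *)
Definition OCsub (L : language) (s : substitution L) (m : MV) : set MV :=
  match m with
  | Vr i => [set Vr (sub_vr s i)]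
  | Fm f => OC (sub_fm s f)
  end.

(* D^s *)
Definition DVsub (L : language) (s : substitution L) (D : set (set MV)) :
    set (set MV) :=
  [set A | exists m n, [/\ m <> n, A = [set m; n] &
     exists m' n', [/\ D [set m'; n'], OCsub s m' m & OCsub s n' n]]].

Definition legitimate (L : language) (s : substitution L) (Phi : scheme L) :=
  forall m n : MV, DV Phi [set m; n] -> OCsub s m `&` OCsub s n = set0.

Definition instance_of (L : language) (Psi Phi : scheme L) : Prop :=
  exists s : substitution L,
    [/\ legitimate s Phi,
        hyps Psi = apply_sub s @` hyps Phi,
        concl Psi = apply_sub s (concl Phi) &
        DVsub s (DV Phi) `<=` DV Psi].

Definition OCproof (L : language) (Phi : scheme L) (P : seq (MF L)) : set MV :=
  OCset (setOf P) `|` OCscheme Phi.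

Definition DVproof (L : language) (Phi : scheme L) (P : seq (MF L)) :
    set (set MV) :=
  DV Phi `|`
  [set A | exists m n, [/\ (OCproof Phi P `\` OCscheme Phi) m,
                           OCproof Phi P n, m <> n & A = [set m; n]]].

(* Since P ends with [concl Phi] it is nonempty; the default value of [nth] is
   never reached, as only indices below [size P] are used. *)
Definition is_proof (L : language) (S : set (scheme L)) (Phi : scheme L)
    (P : seq (MF L)) : Prop :=
  let line i := nth (concl Phi) P i in
  (exists Q, P = rcons Q (concl Phi)) /\
  forall i, i < size P ->
    hyps Phi (line i) \/
    exists2 J : seq nat, all (fun j => j < i) J &
    exists2 Psi, S Psi &
      instance_of (mkScheme (map line J) (line i) (DVproof Phi P)) Psi.

Definition provable (L : language) (S : set (scheme L)) (Phi : scheme L) :=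
  exists P : seq (MF L), is_proof S Phi P.

Definition independent (L : language) (Phi : scheme L) (S : set (scheme L)) :=
  S Phi /\ ~ provable (S `\ Phi) Phi.

#[warning="-uniform-inheritance"]
Coercion Meta : fmMV >-> MF.

(* The condition DV(m, n). *)
Definition DVc (m n : MV) : set MV := [set m; n].

Definition ax_mp (L : language) (phi psi : fmMV) : scheme L :=
  mkScheme [:: Meta phi; phi ~> psi]%MF
    psi%MF
    set0.

Definition ax_minimp (L : language) (phi psi chi theta tau : fmMV) : scheme L :=
  mkScheme [::]
    (phi ~> ((psi ~> chi) ~> (((theta ~> psi) ~> (chi ~> tau)) ~> (psi ~> tau))))%MF
    set0.

Definition ax_peirce (L : language) (phi psi : fmMV) : scheme L :=
  mkScheme [::]
    (((phi ~> psi) ~> phi) ~> phi)%MF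
    set0.

Definition ax_contrap (L : language) (phi psi : fmMV) : scheme L :=
  mkScheme [::]
    ((phi ~> Neg psi) ~> (psi ~> Neg phi))%MF
    set0.

Definition ax_notelim (L : language) (phi psi : fmMV) : scheme L :=
  mkScheme [::]
    (Neg phi ~> (phi ~> psi))%MF
    set0.

Definition ax_gen (L : language) (x : vrMV) (phi : fmMV) : scheme L :=
  mkScheme [:: Meta phi]
    (All x phi)%MF
    set0.

Definition ax_ALLdistr (L : language) (x : vrMV) (phi psi : fmMV) : scheme L :=
  mkScheme [::]
    (All x (phi ~> psi) ~> (All x phi ~> All x psi))%MF
    set0.

Definition ax_spec (L : language) (x : vrMV) (phi : fmMV) : scheme L :=
  mkScheme [::]
    (All x phi ~> phi)%MF
    set0.

Definition ax_modal5 (L : language) (x : vrMV) (phi : fmMV) : scheme L :=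
  mkScheme [::]
    (Neg (All x phi) ~> All x (Neg (All x phi)))%MF
    set0.

Definition ax_vacGen (L : language) (x : vrMV) (phi : fmMV) : scheme L :=
  mkScheme [::]
    (phi ~> All x phi)%MF
    (setOf [:: DVc x phi]).

Definition ax_ALLcomm (L : language) (x y : vrMV) (phi : fmMV) : scheme L :=
  mkScheme [::]
    (All x (All y phi) ~> All y (All x phi))%MF
    set0.

Definition ax_EQrefl (L : language) (x : vrMV) : scheme L :=
  mkScheme [::]
    (x === x)%MF
    set0.

Definition ax_EQsymm (L : language) (x y : vrMV) : scheme L :=
  mkScheme [::]
    (x === y ~> y === x)%MF
    set0.

Definition ax_EQtrans (L : language) (x y z : vrMV) : scheme L :=
  mkScheme [::]
    (x === y ~> (y === z ~> x === z))%MF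
    set0.

Definition ax_denot (L : language) (x y : vrMV) : scheme L :=
  mkScheme [::]
    (x === x ~> Neg (All y (Neg (y === x))))%MF
    (setOf [:: DVc x y]).

Definition ax_subst (L : language) (x y : vrMV) (phi : fmMV) : scheme L :=
  mkScheme [::]
    (All x (x === y ~> (phi ~> All x (x === y ~> phi))))%MF
    (setOf [:: DVc x y; DVc y phi]).

Definition ax_ALLeq (L : language) (x y : vrMV) (phi : fmMV) : scheme L :=
  mkScheme [::]
    (All x (x === y) ~> (All x phi ~> All y phi))%MF
    set0.

Definition ax_genEq (L : language) (x y z : vrMV) : scheme L :=
  mkScheme [::]
    (Neg (All x (x === y)) ~>
      (Neg (All x (x === z)) ~> (y === z ~> All x (y === z))))%MF
    set0.

Definition TMM (L : language) (x y z : vrMV) (phi psi chi theta tau : fmMV) :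
    set (scheme L) :=
  setOf [::
    ax_mp L phi psi;
    ax_minimp L phi psi chi theta tau;
    ax_peirce L phi psi;
    ax_contrap L phi psi;
    ax_notelim L phi psi;
    ax_gen L x phi;
    ax_ALLdistr L x phi psi;
    ax_spec L x phi;
    ax_modal5 L x phi;
    ax_vacGen L x phi;
    ax_ALLcomm L x y phi;
    ax_EQrefl L x;
    ax_EQsymm L x y;
    ax_EQtrans L x y z;
    ax_denot L x y;
    ax_subst L x y phi;
    ax_ALLeq L x y phi;
    ax_genEq L x y z].

Arguments TMM L _ _ _ _ _ _ _ _ : clear implicits.

(* Main.v *)
(* To see that a scheme is not provable from a set S of schemes, it suffices to
   find a set Q of metaformulas that contains its hypotheses but not its
   conclusion, and that is closed under the legitimate instances of the schemes
   of S. For mp, Q only has to avoid psi. For the propositional axioms, Q is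
   given by a two-valued semantics that ignores the quantifiers, in which all
   equalities are true and the value of an implication or of a negation may
   depend on the syntactic form of its arguments. For the other schemes, Q is
   truth in a first-order structure with a nonstandard equality, a nonstandard
   range of the quantifiers, or quantifiers that ignore some formulas. *)

Require Import Defs.
From mathcomp Require Import all_boot.
From mathcomp Require Import boolp classical_sets functions cardinality.

Set Implicit Arguments.
Unset Strict Implicit.
Unset Printing Implicit Defensive.

Local Open Scope classical_set_scope.

(** * Induction along the lines of a proof *)

Lemma setOf_map (T : Type) (f : nat -> T) (J : seq nat) (a : T) :
  setOf (map f J) a -> exists2 j, j \in J & a = f j.
Proof.
elim: J => //= j J IHJ [->|/IHJ [k kJ ->]].
- by exists j; rewrite // mem_head.
- by exists k; rewrite // inE kJ orbT.
Qed.

(* An upper bound for the sets DV(P), where P ranges over the proofs of Phi. *)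
Definition DVmax (L : language) (Phi : scheme L) : set (set MV) :=
  DV Phi `|` [set A | exists m n, ~ OCscheme Phi m /\ A = [set m; n]].

Lemma not_DVmax (L : language) (Phi : scheme L) (m n : MV) :
  OCscheme Phi m -> OCscheme Phi n -> ~ DV Phi [set m; n] ->
  ~ DVmax Phi [set m; n].
Proof.
move=> Om On nD [//|[p [q [Op /seteqP [_ /(_ p (or_introl erefl))]]]]].
by case=> /= eqp; apply: Op; rewrite eqp.
Qed.

(** Strong induction on the line number; bounding [DVproof] by [DVmax Phi] makes the closure
    condition independent of the particular proof. *)
Lemma provable_ind (L : language) (S : set (scheme L)) (Phi : scheme L)
    (Q : set (MF L)) :
  hyps Phi `<=` Q ->
  (forall Psi s, S Psi -> legitimate s Psi ->
     DVsub s (DV Psi) `<=` DVmax Phi ->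
     (forall h, hyps Psi h -> Q (apply_sub s h)) ->
     Q (apply_sub s (concl Psi))) ->
  provable S Phi -> Q (concl Phi).
Proof.
move=> hypQ axQ [P [[P' defP] stepP]].
have lineQ i : i < size P -> Q (nth (concl Phi) P i).
  have [k] := ubnP i; elim: k i => // k IHk i; rewrite ltnS => le_ik ltiP.
  have [/hypQ //|[J Ji [Psi SPsi [s [leg eqh eqc sD]]]]] := stepP i ltiP.
  move: eqc => /= ->; apply: (axQ _ _ SPsi leg) => [A /sD [/= + _]|h hPsi].
    case=> [|[m [n [[_ nOm] _ _ ->]]]]; first by left.
    by right; exists m, n.
  have: setOf (map (nth (concl Phi) P) J) (apply_sub s h).
    by move: eqh => /= ->; exists h.
  move=> /(@setOf_map _ (nth (concl Phi) P)) [j jJ ->].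
  have lt_ji := allP Ji j jJ.
  by apply: IHk; [exact: leq_trans lt_ji le_ik | exact: ltn_trans lt_ji ltiP].
have := lineQ (size P').
by rewrite defP size_rcons nth_rcons ltnn eqxx; apply.
Qed.

(* What the condition DV(x_i, phi) yields on the value a of phi under a
   substitution fixing x_i. *)
Definition apart (L : language) (D : set (set MV)) (i : vrMV) (a : MF L) :=
  ~ OC a (Vr i) /\ forall m, OC a m -> D [set Vr i; m].

(** * Closure conditions for each scheme *)

Section Closure.

Variables (L : language) (x y z : vrMV) (phi psi chi theta tau : fmMV).
Hypothesis distinct_vr : uniq [:: x; y; z].

Local Notation T := (TMM L x y z phi psi chi theta tau).

Lemma distinct_xy : x <> y.
Proof. by move: distinct_vr => /= /andP[+ _] eq_xy; rewrite eq_xy mem_head. Qed.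

Lemma legitimate_vr (Phi : scheme L) s i j :
  legitimate s Phi -> DV Phi [set Vr i; Vr j] -> sub_vr s i <> sub_vr s j.
Proof.
move=> leg /leg /= /seteqP [+ _] eq_ij => /(_ (Vr (sub_vr s i))).
by apply; split=> //=; rewrite eq_ij.
Qed.

Lemma legitimate_apart (Phi : scheme L) D s i f :
  legitimate s Phi -> DVsub s (DV Phi) `<=` D -> DV Phi [set Vr i; Fm f] ->
  apart D (sub_vr s i) (sub_fm s f).
Proof.
move=> leg sD Dif; have nOC : ~ OC (sub_fm s f) (Vr (sub_vr s i)).
  have /= /seteqP [+ _] := leg _ _ Dif.
  by move=> /(_ (Vr (sub_vr s i))) + O; apply.
split=> // m Om; apply: sD; exists (Vr (sub_vr s i)), m; split=> //.
  by move=> eqm; apply: nOC; rewrite eqm.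
by exists (Vr i), (Fm f).
Qed.

(** Each closure condition is guarded by membership in [S], so that of a removed scheme holds
    vacuously. *)
Lemma closed_not_provable (S : set (scheme L)) (Phi : scheme L)
    (Q : set (MF L)) :
  S `<=` T ->
  hyps Phi `<=` Q -> ~ Q (concl Phi) ->
  (S (ax_mp L phi psi) -> forall a b, Q a -> Q (a ~> b)%MF -> Q b) ->
  (S (ax_minimp L phi psi chi theta tau) -> forall a b c d e,
    Q (a ~> ((b ~> c) ~> (((d ~> b) ~> (c ~> e)) ~> (b ~> e))))%MF) ->
  (S (ax_peirce L phi psi) -> forall a b, Q (((a ~> b) ~> a) ~> a)%MF) ->
  (S (ax_contrap L phi psi) -> forall a b,
    Q ((a ~> Neg b) ~> (b ~> Neg a))%MF) ->
  (S (ax_notelim L phi psi) -> forall a b, Q (Neg a ~> (a ~> b))%MF) ->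
  (S (ax_gen L x phi) -> forall i a, Q a -> Q (All i a)) ->
  (S (ax_ALLdistr L x phi psi) -> forall i a b,
    Q (All i (a ~> b) ~> (All i a ~> All i b))%MF) ->
  (S (ax_spec L x phi) -> forall i a, Q (All i a ~> a)%MF) ->
  (S (ax_modal5 L x phi) -> forall i a,
    Q (Neg (All i a) ~> All i (Neg (All i a)))%MF) ->
  (S (ax_vacGen L x phi) -> forall i a, apart (DVmax Phi) i a ->
    Q (a ~> All i a)%MF) ->
  (S (ax_ALLcomm L x y phi) -> forall i j a,
    Q (All i (All j a) ~> All j (All i a))%MF) ->
  (S (ax_EQrefl L x) -> forall i, Q (i === i)%MF) ->
  (S (ax_EQsymm L x y) -> forall i j, Q (i === j ~> j === i)%MF) ->
  (S (ax_EQtrans L x y z) -> forall i j k,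
    Q (i === j ~> (j === k ~> i === k))%MF) ->
  (S (ax_denot L x y) -> forall i j, i <> j ->
    Q (i === i ~> Neg (All j (Neg (j === i))))%MF) ->
  (S (ax_subst L x y phi) -> forall i j a, i <> j ->
    Q (All i (i === j ~> (a ~> All i (i === j ~> a))))%MF) ->
  (S (ax_ALLeq L x y phi) -> forall i j a,
    Q (All i (i === j) ~> (All i a ~> All j a))%MF) ->
  (S (ax_genEq L x y z) -> forall i j k,
    Q (Neg (All i (i === j)) ~>
      (Neg (All i (i === k)) ~> (j === k ~> All i (j === k))))%MF) ->
  ~ provable S Phi.
Proof.
move=> ST hQ nQ mp minimp peirce contrap notelim gen distr spec modal5 vacGen
  comm refl symm trans denot subst alleq geneq.
apply: contra_not nQ; apply: provable_ind => // Psi s SPsi leg sD hypQ.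
have nxy := distinct_xy.
have TPsi := ST _ SPsi; move: TPsi SPsi leg sD hypQ.
case=> [-> Smp _ _ hypQ|].
  by apply: (mp Smp (sub_fm s phi)); [apply: (hypQ (Meta phi)); left
    | apply: (hypQ (phi ~> psi)%MF); right; left].
case=> [-> Sminimp *|]; first exact: minimp.
case=> [-> Speirce *|]; first exact: peirce.
case=> [-> Scontrap *|]; first exact: contrap.
case=> [-> Snotelim *|]; first exact: notelim.
case=> [-> Sgen _ _ hypQ|].
  by apply: gen => //; apply: (hypQ (Meta phi)); left.
case=> [-> Sdistr *|]; first exact: distr.
case=> [-> Sspec *|]; first exact: spec.
case=> [-> Smodal5 *|]; first exact: modal5.
case=> [-> SvacGen leg sD _|].
  apply: vacGen => //; apply: legitimate_apart leg sD _.
  split; first by left.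
  by exists (Vr x), (Fm phi); split=> //; right=> /=; [right; left | left].
case=> [-> Scomm *|]; first exact: comm.
case=> [-> Srefl *|]; first exact: refl.
case=> [-> Ssymm *|]; first exact: symm.
case=> [-> Strans *|]; first exact: trans.
case=> [-> Sdenot leg _ _|].
  apply: denot => //; apply: legitimate_vr leg _.
  split; first by left.
  exists (Vr x), (Vr y); split=> //; last by case.
    by right; left; left.
  by right; right; left.
case=> [-> Ssubst leg _ _|].
  apply: subst => //; apply: legitimate_vr leg _.
  split; first by left.
  exists (Vr x), (Vr y); split=> //; last by case.
    by right; left.
  by right; right; left; right.
case=> [-> Salleq *|]; first exact: alleq.
by case=> [-> Sgeneq *|//]; exact: geneq.
Qed.

End Closure.

(** * Two-valued models for the propositional axioms *)

Section TruthValues.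

Variables (L : language) (F : fmMV -> bool) (refuted : MF L -> MF L -> bool)
  (negv : MF L -> bool -> bool).

(** Whatever [refuted] and [negv] are, mp and gen preserve truth. *)
Fixpoint bval (a : MF L) : bool :=
  match a with
  | Meta f => F f
  | Eqv _ _ => true
  | Pred _ _ => true
  | All _ b => bval b
  | Neg b => negv b (bval b)
  | Imp b c => ~~ refuted b c && (bval b ==> bval c)
  end.

End TruthValues.

Section PropositionalAxioms.

Variables (L : language) (x y z : vrMV) (phi psi chi theta tau : fmMV).
Hypothesis distinct_vr : uniq [:: x; y; z].
Hypothesis distinct_fm : uniq [:: phi; psi; chi; theta; tau].

Local Notation T := (TMM L x y z phi psi chi theta tau).

Lemma distinct_phi_psi : phi <> psi.
Proof.
by move: distinct_fm => /= /andP[+ _] eq_fm; rewrite eq_fm mem_head.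
Qed.

(** Every other conclusion is an implication, a quantification or an equality, so none of its
    instances is [psi]. *)
Lemma mp_not_provable :
  ~ provable (T `\ ax_mp L phi psi) (ax_mp L phi psi).
Proof.
apply: (closed_not_provable distinct_vr (Q := [set a | a <> Meta psi])) => //=.
- by move=> a [->|[->|//]] // [] /distinct_phi_psi.
- by case=> _ [].
Qed.

(** An implication from a metavariable to an implication is declared false. The conclusion of minimp
    has this form; vacGen, the only other axiom that can start from a metavariable, continues with a
    quantifier. *)
Lemma minimp_not_provable :
  ~ provable (T `\ ax_minimp L phi psi chi theta tau)
      (ax_minimp L phi psi chi theta tau).
Proof.
pose ref (a b : MF L) :=
  match a, b with Meta _, Imp _ _ => true | _, _ => false end.
pose Q := bval xpredT ref (fun=> negb).
(* All metavariables are true, so a refuted implication has a true antecedent; this saves peirce and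
   notelim. *)
have refQ a b : ref a b -> Q a by case: a.
have refN a b : ref a (Neg b) = false by case: a.
have refA a i b : ref a (All i b) = false by case: a.
apply: (closed_not_provable distinct_vr (Q := fun a => Q a)) => //=.
- by move=> _ a b -> /andP[_].
- by case=> _ [].
- move=> _ a b; have := @refQ a b.
  by case: (Q a) (Q b) (ref a b) => [] [] [] //= ->.
- by move=> _ a b; rewrite !refN; case: (Q a) (Q b) => [] [].
- by move=> _ a b; have := @refQ a b; case: (Q a) (ref a b) => [] [] //= ->.
- by move=> _ _ a b; case: (Q a) (Q b) (ref a b) => [] [] [].
- by move=> _ _ a; case: (Q a).
- by move=> _ _ a; case: (Q a).
- by move=> _ i a _; rewrite refA; case: (Q a).
- by move=> _ _ _ a; case: (Q a).
- by move=> _ i j a _; rewrite refA; case: (Q a).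
- by move=> _ _ _ a; case: (Q a).
Qed.

(* Q is intuitionistic truth at the root of a two-element Kripke frame; cl is
   (classical) truth at the other world. *)
Lemma peirce_not_provable :
  ~ provable (T `\ ax_peirce L phi psi) (ax_peirce L phi psi).
Proof.
(* The root forces no metavariable, the other world all but [psi]. So [phi ~> psi] fails at both
   worlds, and [(phi ~> psi) ~> phi] holds at the root while [phi] does not. *)
pose cl := @bval L (fun f => f != psi) (fun _ _ => false) (fun=> negb).
pose ref a b := ~~ (cl a ==> cl b).
pose Q := bval xpred0 ref (fun a _ => ~~ cl a).
(* Truth persists from the root to the other world. *)
have Qcl a : Q a ==> cl a.
  by apply/implyP; elim: a => //= a _ b _; rewrite negbK => /andP[].
have phi_psi : phi != psi by apply/eqP; exact: distinct_phi_psi.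
apply: (closed_not_provable distinct_vr (Q := fun a => Q a)) => //=.
- by rewrite /ref /= eqxx phi_psi.
- by move=> _ a b -> /andP[_].
- move=> _ a b c d e; move: (Qcl a) (Qcl b) (Qcl c) (Qcl d) (Qcl e).
  rewrite /ref /= -/cl.
  case: (Q a) => [/= ->//|_]; case: (Q b) => [/= ->//|_];
  case: (Q c) => [/= ->//|_]; case: (Q d) => [/= ->//|_];
  case: (Q e) => [/= ->//|_];
  by do ?[case: (cl _) => //=].
- by case=> _ [].
- move=> _ a b; move: (Qcl a) (Qcl b); rewrite /ref /= -/cl.
  by case: (Q a) (Q b) (cl a) (cl b) => [] [] [] [].
- move=> _ a b; move: (Qcl a) (Qcl b); rewrite /ref /= -/cl.
  by case: (Q a) (Q b) (cl a) (cl b) => [] [] [] [].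
- move=> _ i a b; move: (Qcl a) (Qcl b); rewrite /ref /= -/cl.
  by case: (Q a) (Q b) (cl a) (cl b) => [] [] [] [].
- by move=> _ i a; rewrite /ref /= -/cl; case: (Q a) (cl a) => [] [].
- by move=> _ i a; rewrite /ref /= -/cl; case: (cl a).
- by move=> _ i a _; rewrite /ref /= -/cl; case: (Q a) (cl a) => [] [].
- by move=> _ i j a; rewrite /ref /= -/cl; case: (Q a) (cl a) => [] [].
- move=> _ i j a _; move: (Qcl a); rewrite /ref /= -/cl.
  by case: (Q a) (cl a) => [] [].
- by move=> _ i j a; rewrite /ref /= -/cl; case: (Q a) (cl a) => [] [].
Qed.

(** Negations of metavariables are false, all others classical. A formula and its negation are still
    never both true, which gives notelim; contrap fails for [phi] false and [psi] true. *)
Lemma contrap_not_provable :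
  ~ provable (T `\ ax_contrap L phi psi) (ax_contrap L phi psi).
Proof.
pose neg (a : MF L) v := if a is Meta _ then false else ~~ v.
pose Q := bval (fun f => f == psi) (fun _ _ => false) neg.
have negQ a : neg a (Q a) ==> ~~ Q a.
  by case: a => //= *; rewrite implybb.
have /eqP/negbTE phi_psi : phi <> psi by exact: distinct_phi_psi.
apply: (closed_not_provable distinct_vr (Q := fun a => Q a)) => //=.
- by rewrite phi_psi eqxx.
- by move=> _ a b ->.
- move=> _ a b c d e.
  by case: (Q a) (Q b) (Q c) (Q d) (Q e) => [] [] [] [] [].
- by move=> _ a b; case: (Q a) (Q b) => [] [].
- by case=> _ [].
- move=> _ a b; move: (negQ a); move: (neg a (Q a)) => n.
  by case: n (Q a) (Q b) => [] [] [].
- by move=> _ _ a b; case: (Q a) (Q b) => [] [].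
- by move=> _ _ a; case: (Q a).
- by move=> _ _ a; case: (Q a).
- by move=> _ _ a _; case: (Q a).
- by move=> _ _ _ a; case: (Q a).
- by move=> _ _ _ a _; case: (Q a).
- by move=> _ _ _ a; case: (Q a).
Qed.

(** All negations are true, as are all metavariables equal to [phi] and no others. *)
Lemma notelim_not_provable :
  ~ provable (T `\ ax_notelim L phi psi) (ax_notelim L phi psi).
Proof.
pose Q := @bval L (fun f => f == phi) (fun _ _ => false) (fun _ _ => true).
have /eqP psi_phi : psi <> phi by move/esym; exact: distinct_phi_psi.
apply: (closed_not_provable distinct_vr (Q := fun a => Q a)) => //=.
- by rewrite eqxx (negbTE psi_phi).
- by move=> _ a b ->.
- move=> _ a b c d e.
  by case: (Q a) (Q b) (Q c) (Q d) (Q e) => [] [] [] [] [].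
- by move=> _ a b; case: (Q a) (Q b) => [] [].
- by move=> _ a b; case: (Q a) (Q b) => [] [].
- by case=> _ [].
- by move=> _ _ a b; case: (Q a) (Q b) => [] [].
- by move=> _ _ a; case: (Q a).
- by move=> _ _ a _; case: (Q a).
- by move=> _ _ _ a; case: (Q a).
- by move=> _ _ _ a _; case: (Q a).
- by move=> _ _ _ a; case: (Q a).
Qed.
End PropositionalAxioms.

(** * Valuations and first-order structures *)

Definition upd (M : Type) (v : nat -> M) (i : nat) (m : M) : nat -> M :=
  fun j => if j == i then m else v j.

Lemma upd_eq (M : Type) (v : nat -> M) i m : upd v i m i = m.
Proof. by rewrite /upd eqxx. Qed.

Lemma upd_neq (M : Type) (v : nat -> M) i j m : j <> i -> upd v i m j = v j.
Proof. by move=> /eqP/negbTE; rewrite /upd => ->. Qed.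

Lemma upd_id (M : Type) (v : nat -> M) i : upd v i (v i) = v.
Proof. by apply: funext => j; rewrite /upd; case: eqP => // ->. Qed.

Lemma upd_upd (M : Type) (v : nat -> M) i m m' :
  upd (upd v i m) i m' = upd v i m'.
Proof. by apply: funext => j; rewrite /upd; case: eqP. Qed.

Lemma updC (M : Type) (v : nat -> M) i j m m' : i <> j ->
  upd (upd v i m) j m' = upd (upd v j m') i m.
Proof.
move=> nij; apply: funext => k; rewrite /upd.
by case: (k =P i) => [->|//]; case: (i =P j).
Qed.

(** One direction suffices: restoring the old value gives the converse. *)
Definition independent_of (M : Type) (i : nat) (A : set (nat -> M)) :=
  forall v m, A v -> A (upd v i m).

Section Frames.

Variables (L : language) (M : Type) (R E : M -> M -> Prop).
Variables (F : fmMV -> set (nat -> M)) (blind : MF L -> bool).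

(* Tarskian truth in a structure with domain M, where E interprets equality,
   with two twists: from the value m of x, the quantifier over x only ranges
   over the values R-accessible from m, and quantifiers in front of formulas of
   the syntactic class blind are ignored. *)
Fixpoint holds (a : MF L) (v : nat -> M) : Prop :=
  match a with
  | Meta f => F f v
  | Eqv i j => E (v i) (v j)
  | Pred _ _ => True
  | All i b =>
      if blind b then holds b v else forall m, R (v i) m -> holds b (upd v i m)
  | Neg b => ~ holds b v
  | Imp b c => holds b v -> holds c v
  end.

(** [OC] also counts bound variables, so every quantifier met is over some [j <> i], and its range
    [R (v j)] survives the update. *)
Lemma holds_upd (i : nat) (a : MF L) (v : nat -> M) (m : M) :
  ~ OC a (Vr i) ->
  (forall f, OC a (Fm f) -> independent_of i (F f)) ->
  holds a (upd v i m) <-> holds a v.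
Proof.
elim: a v => [f|j k|P t|j b IHb|b IHb|b IHb c IHc] v //= nOC indF.
- split; last exact: indF.
  by move=> /(indF f erefl _ (v i)); rewrite upd_upd upd_id.
- by rewrite !upd_neq // => eq_i; apply: nOC; rewrite eq_i; [right | left].
- have nji : j <> i by move=> eq_ji; apply: nOC; left; rewrite /= eq_ji.
  have IH w : holds b (upd w i m) <-> holds b w.
    by apply: IHb => [O|f O]; [apply: nOC | apply: indF]; right.
  case: (blind b); first exact: IH.
  rewrite upd_neq //; split=> h n Rn.
    by rewrite -IH -(updC _ _ _ (nesym nji)); exact: h.
  by rewrite (updC _ _ _ (nesym nji)) IH; exact: h.
- by rewrite IHb.
- rewrite IHb ?IHc //; do ?[by move=> O; apply: nOC; (left + right)];
  by move=> f O; apply: indF; (left + right).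
Qed.

Lemma holds_apart (D : set (set MV)) (i : nat) (a : MF L) (v : nat -> M)
    (m : M) :
  (forall i f, D [set Vr i; Fm f] -> independent_of i (F f)) ->
  apart D i a -> holds a v -> holds a (upd v i m).
Proof.
move=> indF [nOC aD] av; apply/holds_upd => // f Of; exact/indF/aD.
Qed.

Variables (x y z : vrMV) (phi psi chi theta tau : fmMV).
Hypothesis distinct_vr : uniq [:: x; y; z].

Local Notation T := (TMM L x y z phi psi chi theta tau).

(* V is the set of all valuations except in the model refuting gen, where it is
   a single point. *)
Lemma frame_not_provable (S : set (scheme L)) (Phi : scheme L)
    (V : set (nat -> M)) :
  S `<=` T ->
  hyps Phi `<=` [set a | forall v, V v -> holds a v] ->
  ~ (forall v, V v -> holds (concl Phi) v) ->
  (forall a, blind (Neg a) = blind a) ->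
  (forall i a, blind (All i a) = blind a) ->
  (forall i j, blind (i === j)%MF = false) ->
  (forall m, R m m) ->
  (S (ax_gen L x phi) -> V = setT) ->
  (S (ax_ALLdistr L x phi psi) -> forall a, blind a = false) ->
  (S (ax_modal5 L x phi) -> forall m n p, R m n -> R m p -> R n p) ->
  (S (ax_vacGen L x phi) -> forall i f,
    DVmax Phi [set Vr i; Fm f] -> independent_of i (F f)) ->
  (S (ax_EQrefl L x) -> forall m, E m m) ->
  (S (ax_EQsymm L x y) -> forall m n, E m n -> E n m) ->
  (S (ax_EQtrans L x y z) -> forall m n p, E m n -> E n p -> E m p) ->
  (S (ax_denot L x y) -> forall m n, E n n -> exists2 p, R m p & E p n) ->
  (S (ax_subst L x y phi) -> forall m n p,
    E m p -> E n p -> R m n -> m = n) ->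
  (S (ax_ALLeq L x y phi) -> (forall m n, R m n -> m = n) \/
    forall m p, exists2 n, R m n & ~ E n p) ->
  (S (ax_genEq L x y z) -> (forall m n, R m n -> m = n) \/
    forall m, E m m) ->
  ~ provable S Phi.
Proof.
move=> ST hV nV bN bA bE Rrefl gen distr modal5 vacGen refl symm trans denot
  subst alleq geneq.
apply: (closed_not_provable distinct_vr
  (Q := [set a | forall v, V v -> holds a v])) ST hV nV _ _ _ _ _ _ _ _ _ _ _
  _ _ _ _ _ _ _.
- by move=> _ a b Va Vab v Vv; apply: (Vab v Vv); exact: Va.
- move=> _ a b c d e v _ /= _ bc h hb; apply: (h (fun=> hb)); exact: bc.
- move=> _ a b v _ /= h; have [//|na] := pselect (holds a v).
  by apply: h => /na.
- by move=> _ a b v _ /= h hb ha; exact: h.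
- by move=> _ a b v _ /= na /na.
- move=> /gen -> i a Va v _ /=; case: ifP => _; first exact: Va.
  by move=> m _; exact: Va.
- move=> /distr nb i a b v _ /=; rewrite !nb => hab ha m Rm.
  by apply: hab => //; exact: ha.
- move=> _ i a v _ /=; case: ifP => // _ h.
  by rewrite -(upd_id v i); exact: h.
- move=> /modal5 eR i a v _ /=; rewrite bN bA; case: (blind a) => // nh m Rm.
  apply: contra_not nh => h p Rp; rewrite -(upd_upd _ _ m); apply: h.
  by rewrite upd_eq; exact: eR Rm Rp.
- move=> /vacGen indF i a aA v _ /=; case: ifP => // _ h m _.
  by apply: holds_apart h; [exact: indF | exact: aA].
- move=> _ i j a v _ /=; rewrite !bA; case: (blind a) => // h n Rn m Rm.
  (* For [i <> j], updating one variable leaves the range of the other unchanged. *)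
  have [eq_ij|nij] := pselect (i = j); first by subst j; exact: h.
  rewrite -updC //; apply: h; last by rewrite upd_neq //; exact: nesym.
  by rewrite upd_neq in Rm.
- by move=> /refl rE i v _ /=.
- by move=> /symm sE i j v _ /=; exact: sE.
- by move=> /trans tE i j k v _ /=; exact: tE.
- move=> /denot dE i j nij v _ /= Ei; rewrite bN bE => h.
  have [p Rp Ep] := dE (v j) (v i) Ei.
  by apply: (h p Rp); rewrite upd_eq upd_neq.
- move=> /subst dE i j a nij v _ /=.
  (* A visible [m] with [E m (w j)] must equal [w i], so the update changes nothing. *)
  have core w : E (w i) (w j) -> holds a w ->
      if blind (i === j ~> a)%MF then E (w i) (w j) -> holds a w
      else forall m, R (w i) m -> E (upd w i m i) (upd w i m j) ->
             holds a (upd w i m).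
    move=> Ew aw; case: ifP => // _ m Rm.
    rewrite upd_eq upd_neq; last exact: nesym.
    by move=> Em; rewrite -(dE _ _ _ Ew Em Rm) upd_id.
  by case: ifP => _; [exact: core | move=> m _; exact: core].
- move=> /alleq rE i j a v _ /=; rewrite bE => hE.
  have [<- //|nij] := pselect (i = j).
  case: (blind a) => // ha.
  (* Either the quantifiers are vacuous, or the antecedent fails at some visible value. *)
  case: rE => [eqR|/(_ (v i) (v j)) [n Rn []]]; last first.
    by move: (hE n Rn); rewrite upd_eq upd_neq //; exact: nesym.
  by move=> m /eqR <-; rewrite upd_id -(upd_id v i); exact: ha.
- move=> /geneq rE i j k v _ /=; rewrite !bE => nij nik Ejk m Rm.
  case: rE => [eqR|rE]; first by rewrite -(eqR _ _ Rm) upd_id.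
  (* If [i] were [j] or [k], reflexivity of [E] would contradict a negated antecedent. *)
  rewrite !upd_neq // => eq_i; first by apply: nik => n _; rewrite eq_i.
  by apply: nij => n _; rewrite eq_i.
Qed.

End Frames.

(** * Countermodels for the quantifier and equality axioms *)

Section PredicateAxioms.

Variables (L : language) (x y z : vrMV) (phi psi chi theta tau : fmMV).
Hypothesis distinct_vr : uniq [:: x; y; z].
Hypothesis distinct_fm : uniq [:: phi; psi; chi; theta; tau].

Local Notation T := (TMM L x y z phi psi chi theta tau).
Local Notation countermodel M R E F blind V :=
  (@frame_not_provable L M R E F blind x y z phi psi chi theta tau
    distinct_vr _ _ V).

Local Notation total := (fun _ _ => True).
Local Notation any := (fun=> setT).
Local Notation none := (fun=> false).

(** The implication makes every metavariable other than [f0] true. *)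
Definition depends_on_x (M : Type) (f0 : fmMV) (P : set M) (f : fmMV) :
    set (nat -> M) :=
  [set v | f = f0 -> P (v x)].

Lemma depends_on_x_independent (Phi : scheme L) (M : Type) f0 (P : set M) :
  OCscheme Phi (Vr x) -> OCscheme Phi (Fm f0) ->
  ~ DV Phi [set Vr x; Fm f0] ->
  forall i f, DVmax Phi [set Vr i; Fm f] ->
    independent_of i (depends_on_x f0 P f).
Proof.
move=> Ox Of nD i f Dif v m /= hv eq_f; subst f.
rewrite upd_neq; first exact: hv.
by move=> eq_xi; apply: (not_DVmax Ox Of nD); rewrite eq_xi.
Qed.

(** The only valuation considered is constantly true; there [phi] holds, but it fails once [x]
    becomes false. *)
Lemma gen_not_provable :
  ~ provable (T `\ ax_gen L x phi) (ax_gen L x phi).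
Proof.
apply: (countermodel bool total eq (depends_on_x phi id) none
  [set fun=> true]) => //=.
- by move=> a [->|//] v -> _.
- by move=> h; have := h _ erefl false I erefl; rewrite /= upd_eq.
- by case=> _ [].
- move=> _; apply: depends_on_x_independent; last by case=> -[].
    by right; left.
  by right; right.
- by move=> _ m n p -> ->.
- by move=> _ _ n; exists n.
- by move=> _ m n p -> ->.
- by move=> _; right=> _ []; [exists false | exists true].
- by right.
Qed.

(* The quantifier is ignored in front of an implication, so that
   phi -> psi holding at a single value of x does not yield forall x psi. *)
Lemma ALLdistr_not_provable :
  ~ provable (T `\ ax_ALLdistr L x phi psi) (ax_ALLdistr L x phi psi).
Proof.
pose implicational := fix imp (a : MF L) :=
  match a with
  | Imp _ _ => true
  | All _ b => imp b
  | Neg b => imp b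
  | _ => false
  end.
apply: (countermodel bool total eq (depends_on_x psi id) implicational
  setT) => //=.
(* Here [phi] is always true, and [psi] says that [x] is true. *)
- move=> h; have := h (fun=> true) I; rewrite /depends_on_x /=.
  move=> /(_ (fun _ _ => erefl)) h'.
  have n_fm := distinct_phi_psi distinct_fm.
  have := h' (fun _ _ eq_fm => False_ind _ (n_fm eq_fm)).
  by move=> /(_ false I erefl); rewrite upd_eq.
- by case=> _ [].
- move=> _; apply: depends_on_x_independent; last by case=> -[].
    by right; left; left.
  by right; left; right; right.
- by move=> _ m n p -> ->.
- by move=> _ _ n; exists n.
- by move=> _ m n p -> ->.
- by move=> _; right=> _ []; [exists false | exists true].
- by right.
Qed.

(* No other scheme relies on a condition DV(x, phi), so phi may depend on x. *)
Lemma vacGen_not_provable :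
  ~ provable (T `\ ax_vacGen L x phi) (ax_vacGen L x phi).
Proof.
apply: (countermodel bool total eq (depends_on_x phi id) none setT) => //=.
- move=> h; have := h (fun=> true) I (fun=> isT) false I erefl.
  by rewrite /= upd_eq.
- by case=> _ [].
- by move=> _ m n p -> ->.
- by move=> _ _ n; exists n.
- by move=> _ m n p -> ->.
- by move=> _; right=> _ []; [exists false | exists true].
- by right.
Qed.

(** With an empty equality on one point, all other equality axioms are conditional on something
    false. *)
Lemma EQrefl_not_provable :
  ~ provable (T `\ ax_EQrefl L x) (ax_EQrefl L x).
Proof.
apply: (countermodel unit eq (fun _ _ => False) any none setT) => //=.
- by apply.
- by move=> _ m n p -> ->.
- by case=> _ [].
- by left.
- by left.
Qed.

(** If each value sees only itself, the existence of a [y] equal to [x] fails when [x] and [y]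
    differ. *)
Lemma denot_not_provable :
  ~ provable (T `\ ax_denot L x y) (ax_denot L x y).
Proof.
have nxy : x <> y := distinct_xy distinct_vr.
apply: (countermodel bool eq eq any none setT) => //=.
- move=> /(_ (fun i => i == x) I erefl); apply=> m <-.
  rewrite upd_eq upd_neq // eqxx; case: eqP => // eq_yx.
  by case: nxy.
- by move=> _ m n p -> ->.
- by move=> _ m n p -> ->.
- by case=> _ [].
- by left.
- by left.
Qed.

(** Equality compares first components, while [phi] reads the second component of [x]. *)
Lemma subst_not_provable :
  ~ provable (T `\ ax_subst L x y phi) (ax_subst L x y phi).
Proof.
have nxy : x <> y := distinct_xy distinct_vr.
apply: (countermodel (bool * bool)%type total (fun m n => m.1 = n.1)
  (depends_on_x phi (fun m : bool * bool => m.2)) none setT) => //=.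
- pose v := upd (fun=> (true, true)) x (true, true).
  have Exy w b : w y = (true, true) ->
      (upd w x (true, b) x).1 = (upd w x (true, b) y).1.
    by rewrite upd_eq upd_neq; [move=> -> | exact: nesym].
  have vy : v y = (true, true) by rewrite /v upd_neq //; exact: nesym.
  move=> h; have := h (fun=> (true, true)) I (true, true) I (Exy _ _ erefl).
  rewrite -/v /depends_on_x /=; rewrite {1}/v upd_eq => /(_ (fun=> isT)).
  move=> /(_ (true, false) I (Exy _ _ vy) erefl).
  by rewrite upd_eq.
- move=> _; apply: depends_on_x_independent.
  + by right; left.
  + by right; right; right; left.
  (* Neither {x, y} nor {y, phi} is the pair {x, phi}. *)
  + case=> /= D _; case: D => [|[|//]] /seteqP [sD _].
      by have [] : DVc x y (Fm phi) by apply: sD; right.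
    have [/= [eq_xy]|//] : DVc y phi (Vr x) by apply: sD; left.
    exact: nxy.
- by move=> _ m n p -> ->.
- by move=> _ _ n; exists n.
- by case=> _ [].
- by move=> _; right=> _ [[] b]; [exists (false, b) | exists (true, b)].
- by right.
Qed.

(* Equality identifies the points with the same first component. A point sees
   itself and the points of the other class, except (false, false), so that
   this point is not visible from the points that it sees. *)
Lemma modal5_not_provable :
  ~ provable (T `\ ax_modal5 L x phi) (ax_modal5 L x phi).
Proof.
pose R (m n : bool * bool) := m = n \/ m.1 != n.1 /\ n != (false, false).
apply: (countermodel (bool * bool)%type R (fun m n => m.1 = n.1)
  (depends_on_x phi (fun m : bool * bool => m != (false, false))) none
  setT) => //=.
(* [phi] fails at (false, false), which sees (true, true), from where only points satisfying [phi]
   are visible. *)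
- move=> /(_ (fun=> (false, false)) I) h.
  have: ~ forall m, R (true, true) m -> m != (false, false).
    have := h _ (true, true) (or_intror (conj isT isT)).
    rewrite upd_eq /depends_on_x /= => h' hR; apply: h' => [|m Rm _].
      move=> /(_ (false, false) (or_introl erefl) erefl).
      by rewrite upd_eq.
    by rewrite upd_upd upd_eq; exact: hR.
  by apply=> m [<-|[]].
- by left.
- by case=> _ [].
- move=> _; apply: depends_on_x_independent; last by case=> -[].
    by right; left; left.
  by right; left; right.
- by move=> _ m n p -> ->.
- move=> _ [a b] [c d] _ /=; have [->|nac] := eqVneq a c.
    by exists (c, b); [left |].
  by exists (c, true); [right | ]; split=> //; case: (c).
- by move=> _ m n p mp np [//|[/eqP[]]]; rewrite mp np.
- move=> _; right=> -[a b] [c d] /=; have [->|nac] := eqVneq a c.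
    exists (~~ c, true); last by case: (c).
    by right; split; case: (c).
  by exists (a, b); [left | exact/eqP].
- by right.
Qed.

(** The order false <= true is reflexive and transitive but not symmetric; reflexivity gives denot
    and genEq. *)
Lemma EQsymm_not_provable_without_subst_ALLeq :
  ~ provable ((T `\` setOf [:: ax_subst L x y phi; ax_ALLeq L x y phi])
       `\ ax_EQsymm L x y) (ax_EQsymm L x y).
Proof.
have nxy : x <> y := distinct_xy distinct_vr.
apply: (countermodel bool total implb any none setT) => //=.
- by move=> Psi [[]].
- move=> /(_ (fun i => i == y) I) /=; rewrite eqxx.
  by case: eqP => // _ /(_ isT).
- by move=> _ [].
- by case=> _ [].
- by move=> _ [] [] [].
- by move=> _ _ n nn; exists n.
- by case=> [[_ []]]; left.
- by case=> [[_ []]]; right; left.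
- by right=> -[].
Qed.

(** The same order with vacuous quantifiers, which validate subst and ALLeq at the cost of denot. *)
Lemma EQsymm_not_provable_without_denot :
  ~ provable ((T `\ ax_denot L x y) `\ ax_EQsymm L x y) (ax_EQsymm L x y).
Proof.
have nxy : x <> y := distinct_xy distinct_vr.
apply: (countermodel bool eq implb any none setT) => //=.
- by move=> Psi [[]].
- move=> /(_ (fun i => i == y) I) /=; rewrite eqxx.
  by case: eqP => // _ /(_ isT).
- by move=> _ m n p -> ->.
- by move=> _ [].
- by case=> _ [].
- by move=> _ [] [] [].
- by case=> [[_ []]].
- by left.
- by left.
Qed.

(** A reflexive path on three points with [None] in the middle. *)
Definition similar (m n : option bool) :=
  if m is Some b then n != Some (~~ b) else true.

Lemma similar_refl m : similar m m.
Proof. by case: m => [[]|]. Qed.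

Lemma similar_sym m n : similar m n -> similar n m.
Proof. by case: m n => [[]|] [[]|]. Qed.

Lemma similar_not_trans :
  ~ (forall v : nat -> option bool, True ->
       similar (v x) (v y) -> similar (v y) (v z) -> similar (v x) (v z)).
Proof.
have := distinct_vr; rewrite /= !inE => /and3P[/norP[nxy nxz] nyz _].
(* [x], [y], [z] are sent along the path, end to end. *)
pose v i := if i == y then None else Some (i == x).
move=> /(_ v I); rewrite /v !eqxx (negbTE nxy) ![z == _]eq_sym.
by rewrite (negbTE nyz) (negbTE nxz) => /(_ isT isT).
Qed.

Lemma EQtrans_not_provable_without_subst_ALLeq :
  ~ provable ((T `\` setOf [:: ax_subst L x y phi; ax_ALLeq L x y phi])
       `\ ax_EQtrans L x y z) (ax_EQtrans L x y z).
Proof.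
apply: (countermodel (option bool) total similar any none setT) => //=.
- by move=> Psi [[]].
- exact: similar_not_trans.
- by move=> _; exact: similar_refl.
- by move=> _; exact: similar_sym.
- by case=> _ [].
- by move=> _ _ n nn; exists n.
- by case=> [[_ []]]; left.
- by case=> [[_ []]]; right; left.
- by right; exact: similar_refl.
Qed.

(** As for EQsymm, letting each value see only itself validates subst and ALLeq. *)
Lemma EQtrans_not_provable_without_denot :
  ~ provable ((T `\ ax_denot L x y) `\ ax_EQtrans L x y z) (ax_EQtrans L x y z).
Proof.
apply: (countermodel (option bool) eq similar any none setT) => //=.
- by move=> Psi [[]].
- exact: similar_not_trans.
- by move=> _ m n p -> ->.
- by move=> _; exact: similar_refl.
- by move=> _; exact: similar_sym.
- by case=> _ [].
- by case=> [[_ []]].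
- by left.
- by left.
Qed.

End PredicateAxioms.

Theorem mainTheorem1 (L : language) (x y z : vrMV)
    (phi psi chi theta tau : fmMV)
    (distinct_vr : uniq [:: x; y; z])
    (distinct_fm : uniq [:: phi; psi; chi; theta; tau]) :
  let T := TMM L x y z phi psi chi theta tau in
  (forall Phi : scheme L,
      setOf [::
          ax_mp L phi psi;
          ax_minimp L phi psi chi theta tau;
          ax_peirce L phi psi;
          ax_contrap L phi psi;
          ax_notelim L phi psi;
          ax_gen L x phi;
          ax_ALLdistr L x phi psi;
          ax_vacGen L x phi;
          ax_EQrefl L x;
          ax_denot L x y;
          ax_subst L x y phi;
          ax_modal5 L x phi] Phi ->
      independent Phi T) /\
  (forall Phi : scheme L,
      setOf [::
          ax_EQsymm L x y;
          ax_EQtrans L x y z] Phi ->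
      independent Phi
        (T `\` setOf [::
          ax_subst L x y phi;
          ax_ALLeq L x y phi])
      /\ independent Phi (T `\ ax_denot L x y)).
Proof.
move=> T; split=> Phi.
  move=> Phi_in; split; first by move: Phi_in; rewrite /T /TMM /=; tauto.
  case: Phi_in => [->|]; first exact: mp_not_provable.
  case=> [->|]; first exact: minimp_not_provable.
  case=> [->|]; first exact: peirce_not_provable.
  case=> [->|]; first exact: contrap_not_provable.
  case=> [->|]; first exact: notelim_not_provable.
  case=> [->|]; first exact: gen_not_provable.
  case=> [->|]; first exact: ALLdistr_not_provable.
  case=> [->|]; first exact: vacGen_not_provable.
  case=> [->|]; first exact: EQrefl_not_provable.
  case=> [->|]; first exact: denot_not_provable.
  case=> [->|]; first exact: subst_not_provable.
  by case=> [->|//]; exact: modal5_not_provable.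
move=> Phi_in; have TPhi : T Phi by move: Phi_in; rewrite /T /TMM /=; tauto.
case: Phi_in TPhi => [->|[->|//]] TPhi; (split; split).
(* Schemes are told apart by their conclusions. *)
- by split=> // -[|[|//]] /(congr1 (@concl L)).
- exact: EQsymm_not_provable_without_subst_ALLeq.
- by split=> // /(congr1 (@concl L)).
- exact: EQsymm_not_provable_without_denot.
- by split=> // -[|[|//]] /(congr1 (@concl L)).
- exact: EQtrans_not_provable_without_subst_ALLeq.
- by split=> // /(congr1 (@concl L)).
- exact: EQtrans_not_provable_without_denot.
Qed.
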